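(* Let $\hat V=\hat V_{+}+\hat V_{-}:(0,\infty)\to\mathbb R$, where $\hat V_{+},\hat V_{-}$ are four times differentiable with $\hat V_{+}^{(4)}(r)\ge 0$ and $\hat V_{-}^{(4)}(r)\le 0$ for all $r>0$. Let $m>0$, $\Delta t_n>0$, and let $\bm q_n,\bm q_{n+1}\in\mathbb R^3\setminus\{\bm 0\}$, $\bm p_n,\bm p_{n+1}\in\mathbb R^3$ satisfy the perturbed mid-point integrator $$\bm q_{n+1}-\bm q_n=\frac{\Delta t_n}{m}\,\bm p_{n+\frac12},$$ $$\bm p_{n+1}-\bm p_n=-\Delta t_n\left(\hat V'(\|\bm q\|_{n+\frac12})+\frac{(\|\bm q_{n+1}\|-\|\bm q_n\|)^2}{24}\left(\hat V_{+}'''(\|\bm q_{n+1}\|)+\hat V_{-}'''(\|\bm q_n\|)\right)\right)\frac{\bm q_{n+\frac12}}{\|\bm q\|_{n+\frac12}}.$$ Then $\bm J(\bm q_{n+1},\bm p_{n+1})=\bm J(\bm q_n,\bm p_n)$, and there exist $\xi_1,\xi_2\in(0,1)$ such that $$H(\bm q_{n+1},\bm p_{n+1})-H(\bm q_n,\bm p_n)=\frac{\left(\|\bm q_{n+1}\|-\|\bm q_n\|\right)^4}{48}\left(-\hat V_{+}^{(4)}(\|\bm q\|_{n+\xi_1})+\hat V_{-}^{(4)}(\|\bm q\|_{n+\xi_2})\right)\le 0.$$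
   Context: Single particle of mass $m$ in $\mathbb R^3$ in a central force field with potential $\hat V(\|\bm q\|)$; $\|\cdot\|$ is the Euclidean norm. Hamiltonian: $H(\bm q,\bm p)=\frac{1}{2m}\|\bm p\|^2+\hat V(\|\bm q\|)$. Angular momentum: $\bm J(\bm q,\bm p)=\bm q\times\bm p$. For $\alpha\in[0,1]$: $\bm q_{n+\alpha}:=(1-\alpha)\bm q_n+\alpha\bm q_{n+1}$, $\bm p_{n+\alpha}:=(1-\alpha)\bm p_n+\alpha\bm p_{n+1}$, and $\|\bm q\|_{n+\alpha}:=(1-\alpha)\|\bm q_n\|+\alpha\|\bm q_{n+1}\|$ (which in general differs from $\|\bm q_{n+\alpha}\|$). *)

(* Defs.v *)
From HB Require Import structures.
From mathcomp Require Import all_boot all_order all_algebra.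
From mathcomp Require Import all_classical all_reals.
From mathcomp Require Import topology normedtype derive realfun.

Set Implicit Arguments.
Unset Strict Implicit.
Unset Printing Implicit Defensive.
Import Order.TTheory GRing.Theory Num.Theory.
Import numFieldNormedType.Exports.

Local Open Scope ring_scope.

(* The library norm `|q| on 'rV[R]_n is the sup norm, hence this definition. *)
Definition enorm (R : realType) (n : nat) (q : 'rV[R]_n) : R :=
  Num.sqrt (\sum_(i < n) q 0 i ^+ 2).

(* Indices are added cyclically in 'I_3 (integers mod 3). *)
Definition cross (R : realType) (u v : 'rV[R]_3) : 'rV[R]_3 :=
  \row_(i < 3) (u 0 (i + 1) * v 0 (i + 2) - u 0 (i + 2) * v 0 (i + 1)).

Definition angular_momentum (R : realType) (q p : 'rV[R]_3) : 'rV[R]_3 :=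
  cross q p.

Definition hamiltonian (R : realType) (m : R) (V : R -> R) (q p : 'rV[R]_3) : R :=
  1 / (2 * m) * enorm p ^+ 2 + V (enorm q).

(* q_{n+a}, with q = q_n and q' = q_{n+1} *)
Definition vec_at (R : realType) (q q' : 'rV[R]_3) (a : R) : 'rV[R]_3 :=
  (1 - a) *: q + a *: q'.

(* ||q||_{n+a}: the norms are interpolated, not the vectors, so this is not
   enorm (vec_at q q' a) in general. *)
Definition norm_at (R : realType) (q q' : 'rV[R]_3) (a : R) : R :=
  (1 - a) * enorm q + a * enorm q'.

(* A function on (0, +oo) is represented by a total function of which only the
   restriction to positive reals matters: derivatives at r > 0 are local.
   The k-th derivative derive1n k f is differentiable at every r > 0 for k < n. *)
Definition n_times_differentiable_pos (R : realType) (n : nat) (f : R -> R) : Prop :=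
  forall k : nat, (k < n)%N -> forall r : R, 0 < r -> derivable (derive1n k f) r 1.

(* Main.v *)
(** Pairing the difference of momenta with the difference of positions turns
    the kinetic energy increment into - (|q1| - |q0|) times the discrete force,
    because the mid-point vector pairs with q1 - q0 to half of |q1|^2 - |q0|^2.
    What remains is the error of the corrected mid-point quadrature for the
    potential. Along g t = f (a + t (b - a)), three applications of Rolle
    express the mid-point error through the third derivative of g at two points
    symmetric about 1/2; subtracting the correction compares the average of
    these two values with the one at 1, and IVT followed by Rolle reduces the
    comparison to a single value of the fourth derivative.
    The part [Vm] is the same estimate with the two endpoints exchanged. *)

Require Import Defs.
From HB Require Import structures.
From mathcomp Require Import all_boot all_order all_algebra.
From mathcomp Require Import all_classical all_reals.
From mathcomp Require Import topology normedtype derive realfun.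
From mathcomp Require Import ring lra.

Import Order.TTheory GRing.Theory Num.Theory.
Import numFieldNormedType.Exports.
Local Open Scope ring_scope.

(** * Rolle arguments and the corrected mid-point quadrature *)

Lemma rolle_is_derive (R : realType) (f f' : R -> R) (a b : R) :
  a < b -> (forall x, a <= x <= b -> is_derive x 1 f (f' x)) ->
  f a = f b -> exists2 c, a < c < b & f' c = 0.
Proof.
move=> ab df fab.
have dfo x : x \in `]a, b[ -> derivable f x 1.
  rewrite in_itv /= => /andP[ax xb].
  by have [] : is_derive x 1 f (f' x) by apply: df; rewrite !ltW.
have cf : {within `[a, b], continuous f}%classic.
  apply: derivable_within_continuous => x; rewrite in_itv /= => xab.
  by have [] := df x xab.
have [c cab [_ dc]] := Rolle ab dfo cf fab.
move: cab; rewrite in_itv /= => cab; exists c => //.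
have /andP[ac cb] := cab.
have [_ <-] : is_derive c 1 f (f' c) by apply: df; rewrite !ltW.
exact: dc.
Qed.

(** Since [f1] and [f2] vanish at [a], each zero found by Rolle serves as right endpoint for the
    next application. *)
Lemma rolle3_is_derive (R : realType) (f f1 f2 f3 : R -> R) (a b : R) :
  a < b ->
  (forall x, a <= x <= b -> is_derive x 1 f (f1 x)) ->
  (forall x, a <= x <= b -> is_derive x 1 f1 (f2 x)) ->
  (forall x, a <= x <= b -> is_derive x 1 f2 (f3 x)) ->
  f a = f b -> f1 a = 0 -> f2 a = 0 -> exists2 c, a < c < b & f3 c = 0.
Proof.
move=> ab d0 d1 d2 fab f1a f2a.
have sub c x : c < b -> a <= x <= c -> a <= x <= b.
  by move=> cb /andP[-> xc]; rewrite (le_trans xc) ?ltW.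
have [c1 /andP[ac1 c1b] f1c1] := rolle_is_derive _ _ _ _ _ ab d0 fab.
have [c2 /andP[ac2 c2c1] f2c2] : exists2 c, a < c < c1 & f2 c = 0.
  by apply: (@rolle_is_derive _ f1) => // [x /(sub _ _ c1b)/d1//|]; rewrite f1a.
have c2b := lt_trans c2c1 c1b.
have [c3 /andP[ac3 c3c2] f3c3] : exists2 c, a < c < c2 & f3 c = 0.
  by apply: (@rolle_is_derive _ f2) => // [x /(sub _ _ c2b)/d2//|]; rewrite f2a.
by exists c3; rewrite // ac3 (lt_trans c3c2).
Qed.

Lemma is_derive_affine (R : realType) (f : R -> R) (df a k t : R) :
  is_derive (a + t * k) 1 f df ->
  is_derive t 1 (fun s => f (a + s * k)) (df * k).
Proof.
move=> fd.
have ad : is_derive t 1 (fun s : R => a + s * k) k.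
  by apply: is_derive_eq; rewrite ?scaler0 ?add0r /GRing.scale /=; ring.
by have := @is_derive1_comp _ f _ t _ _ fd ad.
Qed.

Lemma midpoint_corrected_unit (R : realType) (g g1 g2 g3 g4 : R -> R) :
  (forall t : R, 0 <= t <= 1 -> is_derive t 1 g (g1 t)) ->
  (forall t : R, 0 <= t <= 1 -> is_derive t 1 g1 (g2 t)) ->
  (forall t : R, 0 <= t <= 1 -> is_derive t 1 g2 (g3 t)) ->
  (forall t : R, 0 <= t <= 1 -> is_derive t 1 g3 (g4 t)) ->
  exists2 xi, 0 < xi < 1 &
    g 1 - g 0 - g1 (1 / 2) - g3 1 / 24 = - (g4 xi / 48).
Proof.
move=> d0 d1 d2 d3.
pose M := g 1 - g 0 - g1 (1 / 2).
(* The factors 1 and -1 make both reflections about 1/2 instances of [is_derive_affine]. *)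
have dsym (f f' : R -> R) (t : R) :
    (forall t : R, 0 <= t <= 1 -> is_derive t 1 f (f' t)) -> 0 <= t <= 1 / 2 ->
    is_derive t 1 (fun s => f (1 / 2 + s * 1)) (f' (1 / 2 + t * 1) * 1) /\
    is_derive t 1 (fun s => f (1 / 2 + s * -1)) (f' (1 / 2 + t * -1) * -1).
  by move=> df t01; split; apply: is_derive_affine; apply: df; lra.
(* The cubic term makes [phi (1 / 2) = phi 0] without affecting [phi], [phi1], [phi2] at 0. *)
pose phi (t : R) := g (1 / 2 + t * 1) - g (1 / 2 + t * -1)
  - t * (2 * g1 (1 / 2)) - t ^+ 3 * (8 * M).
pose phi1 (t : R) := g1 (1 / 2 + t * 1) + g1 (1 / 2 + t * -1)
  - 2 * g1 (1 / 2) - t ^+ 2 * (24 * M).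
pose phi2 (t : R) := g2 (1 / 2 + t * 1) - g2 (1 / 2 + t * -1) - t * (48 * M).
pose phi3 (t : R) := g3 (1 / 2 + t * 1) + g3 (1 / 2 + t * -1) - 48 * M.
(* A zero of [phi3] expresses [48 * M] as the sum of [g3] at the two points [1 / 2 - tau] and
   [1 / 2 + tau]. *)
have [tau /andP[tau0 tau1] phi3tau] : exists2 c, 0 < c < 1 / 2 & phi3 c = 0.
  apply: (@rolle3_is_derive _ phi phi1 phi2); first lra.
  - move=> t t01; have [da db] := dsym _ _ _ d0 t01.
    by rewrite /phi; apply: is_derive_eq; rewrite /phi1 /GRing.scale /=; ring.
  - move=> t t01; have [da db] := dsym _ _ _ d1 t01.
    by rewrite /phi1; apply: is_derive_eq; rewrite /phi2 /GRing.scale /=; ring.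
  - move=> t t01; have [da db] := dsym _ _ _ d2 t01.
    by rewrite /phi2; apply: is_derive_eq; rewrite /phi3 /GRing.scale /=; ring.
  - rewrite /phi !mul0r !addr0 expr0n /= mul0r.
    rewrite (_ : 1 / 2 + 1 / 2 * 1 = 1 :> R); last by field.
    rewrite (_ : 1 / 2 + 1 / 2 * -1 = 0 :> R); last by field.
    by rewrite /M; field.
  - by rewrite /phi1 !mul0r !addr0 expr0n /= mul0r; ring.
  - by rewrite /phi2 !mul0r !addr0; ring.
(* [C] is such that [h 1] is the average of [h] at [1 / 2 - tau] and [1 / 2 + tau]. *)
pose C := 2 * g3 1 - 48 * M.
pose h t := g3 t - t * C.
have dh (t : R) : 0 <= t <= 1 -> is_derive t 1 h (g4 t - C).
  move=> /d3 ?; rewrite /h; apply: is_derive_eq; rewrite /GRing.scale /=; ring.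
have havg : h (1 / 2 + tau) + h (1 / 2 - tau) = 2 * h 1.
  move: phi3tau; rewrite /phi3 /h /C mulr1 mulrN1; lra.
(* An average lies between the two values it averages. As [tau < 1 / 2], also [y < 1], which leaves
   room for Rolle on [[y, 1]]. *)
have [y /andP[ty yt] hy] :
    exists2 y, 1 / 2 - tau <= y <= 1 / 2 + tau & h y = h 1.
  have [|||y yI hy] := @IVT _ h (1 / 2 - tau) (1 / 2 + tau) (h 1).
  - lra.
  - apply: derivable_within_continuous => x; rewrite in_itv /= => /andP[x0 x1].
    by have [] : is_derive x 1 h (g4 x - C) by apply: dh; lra.
  - rewrite ge_min le_max.
    by case: (lerP (h (1 / 2 - tau)) (h 1)) => ?; apply/andP; split; lra.
  - by exists y.
have [xi xiI hxi] : exists2 c, y < c < 1 & g4 c - C = 0.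
  apply: (@rolle_is_derive _ h) => // [|x xI]; first lra.
  by apply: dh; lra.
exists xi; first lra.
rewrite (_ : g4 xi = C); last lra.
by rewrite /C /M; field.
Qed.

Lemma n_times_differentiable_is_derive (R : realType) (n k : nat) (f : R -> R)
    (r : R) :
  n_times_differentiable_pos n f -> (k < n)%N -> 0 < r ->
  is_derive r 1 (derive1n k f) (derive1n k.+1 f r).
Proof.
move=> df kn r0; rewrite derive1nS derive1E.
by apply: DeriveDef; [exact: df|].
Qed.

(** Rescaling to the unit interval: [g k] is the k-th derivative of [f (a + t * (b - a))] in [t]. No
    order between [a] and [b] is assumed, so the endpoints may be exchanged. *)
Lemma midpoint_corrected (R : realType) (f : R -> R) (a b : R) :
  n_times_differentiable_pos 4 f -> 0 < a -> 0 < b ->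
  exists2 xi, 0 < xi < 1 &
    f b - f a - (b - a) * derive1n 1 f (a + 1 / 2 * (b - a))
      - (b - a) ^+ 3 / 24 * derive1n 3 f b
    = - ((b - a) ^+ 4 / 48 * derive1n 4 f (a + xi * (b - a))).
Proof.
move=> df a0 b0.
pose g k (t : R) := derive1n k f (a + t * (b - a)) * (b - a) ^+ k.
have dg k (t : R) : (k < 4)%N -> 0 <= t <= 1 -> is_derive t 1 (g k) (g k.+1 t).
  move=> k4 /andP[t0 t1].
  have r0 : 0 < a + t * (b - a) by nra.
  have d := is_derive_affine _ _ _ _ _ _
    (n_times_differentiable_is_derive _ _ _ _ _ df k4 r0).
  rewrite /g; apply: is_derive_eq.
  rewrite scaler0 add0r /GRing.scale /= exprS; ring.
have [xi xiI] := midpoint_corrected_unit _ _ _ _ _ _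
  (fun t => dg 0%N t isT) (fun t => dg 1%N t isT) (fun t => dg 2%N t isT)
  (fun t => dg 3%N t isT).
rewrite /g mul1r mul0r addr0 (addrC a (b - a)) subrK => E.
exists xi => //; move: E; rewrite !derive1n0 expr0 expr1 !mulr1 => E.
rewrite (_ : (b - a) ^+ 4 / 48 * _ =
  derive1n 4 f (a + xi * (b - a)) * (b - a) ^+ 4 / 48); last by ring.
by rewrite -E; ring.
Qed.

(** * Euclidean norm, and the two balance laws of a mid-point step *)

Lemma enorm_sqr (R : realType) (n : nat) (q : 'rV[R]_n) :
  enorm q ^+ 2 = \sum_(i < n) q 0 i ^+ 2.
Proof. by rewrite sqr_sqrtr // sumr_ge0 // => i _; exact: sqr_ge0. Qed.

Lemma enorm_gt0 (R : realType) (n : nat) (q : 'rV[R]_n) : q <> 0 -> 0 < enorm q.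
Proof.
move=> q0; rewrite lt_neqAle sqrtr_ge0 andbT; apply/eqP => eq0; apply: q0.
have /psumr_eq0P z : \sum_(i < n) q 0 i ^+ 2 = 0 by rewrite -enorm_sqr -eq0 expr0n.
apply/rowP => i; rewrite mxE; apply/eqP; rewrite -sqrf_eq0; apply/eqP/z => // j _.
exact: sqr_ge0.
Qed.

(** The increment of the cross product is the increment of q times the mid-point of p plus the
    mid-point of q times the increment of p; both are products of parallel vectors. *)
Lemma angular_momentum_step (R : realType) (k l : R) (q0 q1 p0 p1 : 'rV[R]_3) :
  q1 - q0 = k *: vec_at p0 p1 (1 / 2) ->
  p1 - p0 = l *: vec_at q0 q1 (1 / 2) ->
  angular_momentum q1 p1 = angular_momentum q0 p0.
Proof.
move=> /rowP eq /rowP ep; apply/rowP => i; rewrite !mxE.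
have E (j : 'I_3) : q1 0 j = q0 0 j + k * ((p0 0 j + p1 0 j) / 2) /\
    p1 0 j = p0 0 j + l * ((q0 0 j + q1 0 j) / 2).
  have := eq j; have := ep j; rewrite !mxE => epj eqj.
  by split; [move: eqj|move: epj]; lra.
move: (i + 1) (i + 2) => j j'.
have [qj pj] := E j; have [qj' pj'] := E j'.
set a := q0 0 j in qj pj *; set a1 := q1 0 j in qj pj *.
set b := p0 0 j in qj pj *; set b1 := p1 0 j in qj pj *.
set c := q0 0 j' in qj' pj' *; set c1 := q1 0 j' in qj' pj' *.
set d := p0 0 j' in qj' pj' *; set d1 := p1 0 j' in qj' pj' *.
have -> : a1 * d1 - c1 * b1 = a * d - c * b
  + ((a1 - a) * ((d + d1) / 2) - (c1 - c) * ((b + b1) / 2))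
  + ((a + a1) / 2 * (d1 - d) - (c + c1) / 2 * (b1 - b)) by field.
have -> : a1 - a = k * ((b + b1) / 2) by rewrite {1}qj; ring.
have -> : c1 - c = k * ((d + d1) / 2) by rewrite {1}qj'; ring.
have -> : b1 - b = l * ((a + a1) / 2) by rewrite {1}pj; ring.
have -> : d1 - d = l * ((c + c1) / 2) by rewrite {1}pj'; ring.
ring.
Qed.

(** Both sides equal twice the inner product of [p1 - p0] and [q1 - q0]. *)
Lemma kinetic_energy_step (R : realType) (k l : R) (q0 q1 p0 p1 : 'rV[R]_3) :
  q1 - q0 = k *: vec_at p0 p1 (1 / 2) ->
  p1 - p0 = l *: vec_at q0 q1 (1 / 2) ->
  k * (enorm p1 ^+ 2 - enorm p0 ^+ 2) = l * (enorm q1 ^+ 2 - enorm q0 ^+ 2).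
Proof.
move=> /rowP eq /rowP ep; rewrite !enorm_sqr -!sumrB !mulr_sumr.
apply: eq_bigr => i _; have := eq i; have := ep i; rewrite !mxE.
move: (q0 0 i) (q1 0 i) (p0 0 i) (p1 0 i) => a a1 b b1 epi eqi.
have -> : k * (b1 ^+ 2 - b ^+ 2) =
  2 * (b1 - b) * (k * ((1 - 1 / 2) * b + 1 / 2 * b1)) by field.
by rewrite -eqi epi; field.
Qed.

(** * Energy balance of the integrator *)

Theorem proposition3 (R : realType) (V Vp Vm : R -> R) (m dt : R)
    (q0 q1 p0 p1 : 'rV[R]_3)
    (hV : forall r : R, 0 < r -> V r = Vp r + Vm r)
    (dVp : n_times_differentiable_pos 4 Vp)
    (dVm : n_times_differentiable_pos 4 Vm)
    (Vp4_ge0 : forall r : R, 0 < r -> 0 <= derive1n 4 Vp r)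
    (Vm4_le0 : forall r : R, 0 < r -> derive1n 4 Vm r <= 0)
    (m_gt0 : 0 < m) (dt_gt0 : 0 < dt)
    (q0_neq0 : q0 <> 0) (q1_neq0 : q1 <> 0)
    (step_q : q1 - q0 = (dt / m) *: vec_at p0 p1 (1 / 2))
    (step_p : p1 - p0 =
      - (dt * (derive1 V (norm_at q0 q1 (1 / 2)) +
               (enorm q1 - enorm q0) ^+ 2 / 24 *
               (derive1n 3 Vp (enorm q1) + derive1n 3 Vm (enorm q0))))
      *: ((norm_at q0 q1 (1 / 2))^-1 *: vec_at q0 q1 (1 / 2))) :
  angular_momentum q1 p1 = angular_momentum q0 p0 /\
  exists xi1 xi2 : R,
    [/\ 0 < xi1 < 1, 0 < xi2 < 1 &
      let dH := (enorm q1 - enorm q0) ^+ 4 / 48 *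
                (- derive1n 4 Vp (norm_at q0 q1 xi1) + derive1n 4 Vm (norm_at q0 q1 xi2)) in
      hamiltonian m V q1 p1 - hamiltonian m V q0 p0 = dH /\ dH <= 0].
Proof.
rewrite scalerA in step_p.
split; first exact: angular_momentum_step step_q step_p.
have := kinetic_energy_step _ _ _ _ _ _ _ step_q step_p.
rewrite /hamiltonian /norm_at.
have := enorm_gt0 _ _ _ q0_neq0; have := enorm_gt0 _ _ _ q1_neq0.
move: (enorm q0) (enorm q1) => a b b0 a0.
set c := (1 - 1 / 2) * a + 1 / 2 * b.
have pos (t : R) : 0 < t < 1 -> 0 < (1 - t) * a + t * b.
  by move=> /andP[t0 t1]; rewrite addr_gt0 // mulr_gt0 // subr_gt0.
have c0 : 0 < c by apply: pos; rewrite divr_gt0 //= ltr_pdivrMr // mul1r ltr1n.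
have [x xI Ex] := midpoint_corrected _ _ _ _ dVp a0 b0.
have [y yI Ey] := midpoint_corrected _ _ _ _ dVm b0 a0.
have dV : derive1 V c = derive1n 1 Vp c + derive1n 1 Vm c.
  have := n_times_differentiable_is_derive _ _ 0%N _ _ dVp isT c0.
  have := n_times_differentiable_is_derive _ _ 0%N _ _ dVm isT c0.
  rewrite !derive1n0 => dm dp.
  (* [V] splits only on positive reals, which contain a neighbourhood of [c]. *)
  rewrite derive1E (@near_eq_derive _ _ _ V (Vp \+ Vm)) ?oner_neq0 //.
    have d : is_derive c 1 (Vp + Vm) (derive1n 1 Vp c + derive1n 1 Vm c).
      exact: is_deriveD.
    by have [] := d.
  near=> r; apply: hV; near: r; exact: lt_nbhsr.
rewrite dV => K.
have y'I : 0 < 1 - y < 1 by case/andP: yI => y0 y1; rewrite subr_gt0 y1 gtrBl.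
(* The quadrature for [Vm] runs from [b] to [a], so its parameter [y] is reversed. *)
exists x, (1 - y); split; [by []|exact: y'I|cbv zeta].
move: Ex Ey.
have -> : a + 1 / 2 * (b - a) = c by rewrite /c; field.
have -> : b + 1 / 2 * (a - b) = c by rewrite /c; field.
have -> : a + x * (b - a) = (1 - x) * a + x * b by ring.
have -> : b + y * (a - b) = (1 - (1 - y)) * a + (1 - y) * b by ring.
have /Vp4_ge0 := pos _ xI.
have /Vm4_le0 := pos _ y'I.
move: (derive1n 4 Vp _) (derive1n 4 Vm _) => vp vm vm0 vp0 Ex Ey.
split; last first.
  apply: mulr_ge0_le0; first by rewrite divr_ge0 ?(@exprn_even_ge0 _ 4).
  by rewrite addrC subr_le0 (le_trans vm0).
move: K Ex Ey; rewrite !hV //.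
move: (derive1n 1 Vp c) (derive1n 3 Vp b) (Vp a) (Vp b) => vp1 vp3 vpa vpb.
move: (derive1n 1 Vm c) (derive1n 3 Vm a) (Vm a) (Vm b) => vm1 vm3 vma vmb.
move: (enorm p0 ^+ 2) (enorm p1 ^+ 2) => s0 s1 K Ex Ey.
(* The factor [c^-1] cancels because [b ^+ 2 - a ^+ 2 = 2 * (b - a) * c]. *)
have Kin : 1 / (2 * m) * (s1 - s0) =
    - (b - a) * (vp1 + vm1 + (b - a) ^+ 2 / 24 * (vp3 + vm3)).
  have m0 : m != 0 by rewrite gt_eqF.
  have dt0 : dt != 0 by rewrite gt_eqF.
  have ab0 : a + b != 0 by rewrite gt_eqF ?addr_gt0.
  apply: (mulfI (x := 2 * dt)); first by rewrite mulf_neq0 ?pnatr_eq0.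
  rewrite (_ : 2 * dt * _ = dt / m * (s1 - s0)); last by field.
  have cE : c = (a + b) / 2 by rewrite /c; field.
  by rewrite K cE; field.
(* [Kin + Ex - Ey]: the first and third derivatives cancel, and subtracting [Ey] gives the [Vm] term
   its opposite sign. *)
by clear - Kin Ex Ey; lra.
Unshelve. all: by end_near. Qed.
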